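(* If $G$ is a finite simple connected graph with at least two vertices and $n\in\{4,5\}$, then $o(G\circ C_n)=\mathcal{R}$ and $R_{\rm MB}(G\circ C_n)=R_{\rm MB}'(G\circ C_n)=2n(G)$.
   Context: $C_n$ is the cycle on $n$ vertices; $n(G)$ is the number of vertices of $G$. The lexicographic product $G\circ H$ has vertex set $V(G)\times V(H)$, with $(g,h)(g',h')$ an edge iff $gg'\in E(G)$, or $g=g'$ and $hh'\in E(H)$. A set $W\subseteq V(X)$ is a resolving set of a connected graph $X$ if for every two distinct vertices $x,y$ there is $z\in W$ with $d(x,z)\ne d(y,z)$. In the Maker-Breaker resolving game on $X$, Resolver and Spoiler alternately select unplayed vertices of $X$; Resolver wins if the vertices he selects contain a resolving set of $X$, and Spoiler wins if she selects at least one vertex of every resolving set of $X$. The R-game has Resolver moving first; the S-game has Spoiler moving first. $o(X)=\mathcal{R}$ means Resolver has a winning strategy no matter who starts. $R_{\rm MB}(X)$ (resp. $R_{\rm MB}'(X)$) is the minimum number of moves Resolver needs to win the R-game (resp. S-game) under optimal play of both players. *)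

(* Defs.v *)
From mathcomp Require Import all_boot.

Set Implicit Arguments.
Unset Strict Implicit.
Unset Printing Implicit Defensive.

Record sgraph := SGraph {
  vert :> finType;
  edge : rel vert;
  edge_sym : symmetric edge;
  edge_irr : irreflexive edge
}.

Definition connected_graph (X : sgraph) : bool :=
  [forall x : X, forall y : X, connect (@edge X) x y].

(* The conjunct [i != j] only matters for n = 1. *)
Definition cycle_edge (n : nat) : rel 'I_n :=
  fun i j => (i != j) && ((j == ordS i) || (i == ordS j)).

Lemma cycle_edge_sym n : symmetric (@cycle_edge n).
Proof. by move=> i j; rewrite /cycle_edge eq_sym orbC. Qed.

Lemma cycle_edge_irr n : irreflexive (@cycle_edge n).
Proof. by move=> i; rewrite /cycle_edge eqxx. Qed.

Definition cycle_graph (n : nat) : sgraph :=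
  SGraph (@cycle_edge_sym n) (@cycle_edge_irr n).

Section LexProduct.
Variables G H : sgraph.

Definition lex_edge : rel (G * H) :=
  fun u v => edge u.1 v.1 || ((u.1 == v.1) && edge u.2 v.2).

Lemma lex_edge_sym : symmetric lex_edge.
Proof.
by move=> u v; rewrite /lex_edge edge_sym eq_sym [edge u.2 _]edge_sym.
Qed.

Lemma lex_edge_irr : irreflexive lex_edge.
Proof. by move=> u; rewrite /lex_edge !edge_irr andbF. Qed.

Definition lexprod : sgraph := SGraph lex_edge_sym lex_edge_irr.
End LexProduct.

Section Metric.
Variable X : sgraph.

Definition walk_of_length (x y : X) (k : nat) : bool :=
  [exists p : k.-tuple X, path (@edge X) x p && (last x p == y)].

(* Shortest walks have length < #|X|; the value is #|X| if y is unreachable. *)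
Definition dist (x y : X) : nat := find (walk_of_length x y) (iota 0 #|X|).

Lemma distP (x y : X) : connect (@edge X) x y ->
  walk_of_length x y (dist x y) /\
  (forall k, walk_of_length x y k -> dist x y <= k).
Proof.
case/connectP=> p0 /shortenP[p e_p Up _] ->{p0}.
have lt_p : size p < #|X|.
  by have := max_card (mem (x :: p)); rewrite (card_uniqP Up).
set y0 := last x p.
have wp : walk_of_length x y0 (size p).
  by apply/existsP; exists (in_tuple p); rewrite e_p eqxx.
have hw : has (walk_of_length x y0) (iota 0 #|X|).
  by apply/hasP; exists (size p); rewrite // mem_iota.
have lt_d : dist x y0 < #|X| by move: hw; rewrite has_find size_iota.
split; first by have := nth_find 0 hw; rewrite -/(dist _ _) nth_iota.
move=> k wk; rewrite leqNgt; apply/negP=> lt_k.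
have := before_find 0 lt_k; rewrite nth_iota ?wk //.
exact: ltn_trans lt_k lt_d.
Qed.

Definition resolving (W : {set X}) : bool :=
  [forall x : X, forall y : X,
    (x != y) ==> [exists z in W, dist x z != dist y z]].
End Metric.

Section ResolvingGame.
Variable X : sgraph.

(* [rfirst] says whether Resolver moves first; moves are numbered from 0. *)
Definition resolver_turn (rfirst : bool) (i : nat) : bool := odd i (+) rfirst.

(* A play is continued until the board is exhausted and is thus an enumeration
   of the vertices in the order of selection. This is harmless: the first
   player to reach his goal keeps it, and prevents the opponent's (see
   [resolver_or_spoiler] below). *)
Definition is_play (s : #|X|.-tuple X) : bool := uniq s.

Definition resolver_seq (rfirst : bool) (s : seq X) : seq X :=
  [seq x <- s | resolver_turn rfirst (index x s)].

Definition spoiler_seq (rfirst : bool) (s : seq X) : seq X :=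
  [seq x <- s | ~~ resolver_turn rfirst (index x s)].

Definition resolver_wins_with (s : seq X) : bool :=
  [exists W : {set X}, resolving W && (W \subset s)].

Definition spoiler_wins_with (s : seq X) : bool :=
  [forall W : {set X}, resolving W ==> [exists x in W, x \in s]].

Lemma resolver_or_spoiler rfirst (s : #|X|.-tuple X) : is_play s ->
  resolver_wins_with (resolver_seq rfirst s) =
  ~~ spoiler_wins_with (spoiler_seq rfirst s).
Proof.
move=> Us; have mem_s x : x \in tval s.
  have cs : #|[set y in tval s]| = #|X|.
    by rewrite cardsE (card_uniqP Us) size_tuple.
  have /eqP sT : [set y in tval s] == [set: X].
    by rewrite eqEcard subsetT cardsT cs leqnn.
  by have := in_setT x; rewrite -sT inE.
rewrite negb_forall; apply: eq_existsb => W; rewrite negb_imply; congr andb.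
rewrite negb_exists; apply/subsetP/forallP => h x.
  by apply/negP=> /andP[/h]; rewrite !mem_filter => /andP[->].
by move=> Wx; have := h x; rewrite Wx !mem_filter mem_s !andbT negbK.
Qed.

(* A strategy of Resolver maps the list of all moves made so far (earliest
   first) to his next move. *)
Definition strategy : Type := {ffun {bseq #|X| of X} -> X}.

Definition legal (sigma : strategy) : bool :=
  [forall h : {bseq #|X| of X}, (size h < #|X|) ==> (sigma h \notin val h)].

Definition follows (rfirst : bool) (sigma : strategy) (s : #|X|.-tuple X) :=
  [forall i : 'I_#|X|, resolver_turn rfirst i ==>
    (tnth s i == sigma (insub_bseq #|X| (take i s)))].

Definition resolver_wins (rfirst : bool) : bool :=
  [exists sigma : strategy, legal sigma &&
    [forall s : #|X|.-tuple X, (is_play s && follows rfirst sigma s) ==>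
       resolver_wins_with (resolver_seq rfirst s)]].

Definition resolver_wins_within (rfirst : bool) (k : nat) : bool :=
  [exists sigma : strategy, legal sigma &&
    [forall s : #|X|.-tuple X, (is_play s && follows rfirst sigma s) ==>
       resolver_wins_with (take k (resolver_seq rfirst s))]].

Definition outcome_R : Prop := forall rfirst : bool, resolver_wins rfirst.

(* The least number of his own moves in which Resolver can force a win;
   [None] (infinity) if he cannot. *)
Definition min_moves (rfirst : bool) : option nat :=
  ohead [seq k <- iota 0 #|X|.+1 | resolver_wins_within rfirst k].

Definition R_MB : option nat := min_moves true.
Definition R_MB' : option nat := min_moves false.
End ResolvingGame.

(* Main.v *)
Require Import Defs.
From mathcomp Require Import all_boot.

(** Distances 0 and 1 suffice to see that a set is resolving: it is enough that
    in every layer it contains a pair of vertices of the cycle which resolves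
    the cycle, and which in addition has no common neighbour if the base vertex
    has a true twin, and is dominating if it has a false twin (no vertex has
    twins of both kinds). An edge of C_4 has all these properties; in C_5 take
    an edge in the first case and a non-edge in the second. Resolver answers in
    the layer where Spoiler has just played: if it was untouched, with a vertex
    leaving two ways to complete a wanted pair, and otherwise by completing the
    pair; if that layer is already complete, he starts or completes another one.
    So no move is wasted and he wins with two vertices per layer. Fewer do not
    suffice, for the reflection of a single layer that fixes one given vertex
    is an automorphism of the product. *)

Set Implicit Arguments.
Unset Strict Implicit.
Unset Printing Implicit Defensive.

(** * Distances *)

Section Distances.
Variable X : sgraph.

Lemma walk_of_length0 (x y : X) : walk_of_length x y 0 = (x == y).
Proof.
apply/existsP/idP=> [[p]|xy]; first by rewrite (tuple0 p).
by exists [tuple].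
Qed.

Lemma walk_of_length1 (x y : X) : walk_of_length x y 1 = edge x y.
Proof.
apply/existsP/idP=> [[p]|xy]; last by exists [tuple y]; rewrite /= xy eqxx.
by case/tupleP: p => z p; rewrite (tuple0 p) /= andbT => /andP[? /eqP <-].
Qed.

(** The form [(dist x y).-2.+2] records that all remaining distances are at least 2; the default
    value [#|X|] for unreachable vertices complies. *)
Lemma dist_le1 (x y : X) : 1 < #|X| ->
  dist x y = if x == y then 0 else if edge x y then 1 else (dist x y).-2.+2.
Proof.
rewrite /dist; case: #|X| => [|[|m]] // _ /=.
by rewrite walk_of_length0 walk_of_length1; case: (x == y); case: (edge x y).
Qed.

Lemma dist_neq (x y z : X) : x != y ->
  [|| z == x, z == y | edge x z != edge y z] -> dist x z != dist y z.
Proof.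
move=> xy h; have cX : 1 < #|X|.
  by apply: leq_trans (max_card (mem [set x; y])); rewrite cards2 xy.
move: h; rewrite !(eq_sym z) (dist_le1 x z cX) (dist_le1 y z cX).
case: (eqVneq x z) => [ex|_]; case: (eqVneq y z) => [ey|_] //=.
- by rewrite ex ey eqxx in xy.
- by case: (edge y z).
- by case: (edge x z).
- by case: (edge x z); case: (edge y z).
Qed.

Lemma dist_involution (f : X -> X) : involutive f ->
  {homo f : x y / edge x y} -> forall x y, dist (f x) (f y) = dist x y.
Proof.
move=> fK f_edge x y.
have walk_f u v k : walk_of_length u v k -> walk_of_length (f u) (f v) k.
  case/existsP=> p /andP[e_p /eqP <-]; apply/existsP.
  by exists [tuple of map f p]; rewrite /= last_map eqxx andbT (homo_path f_edge).
apply: eq_find => k; apply/idP/idP => /walk_f //; by rewrite !fK.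
Qed.

End Distances.

(** * Forcing a win by an invariant *)

Section InvariantStrategy.
Variables (X : sgraph) (rfirst : bool).
Implicit Types (h s : seq X) (A P : {set X}).

Lemma resolver_seq_rcons h x : x \notin h ->
  resolver_seq rfirst (rcons h x) =
    if resolver_turn rfirst (size h) then rcons (resolver_seq rfirst h) x
    else resolver_seq rfirst h.
Proof.
move=> hx; rewrite /resolver_seq filter_rcons -cats1 index_cat (negPf hx) /=.
rewrite eqxx addn0; set s1 := filter _ _; set s2 := filter _ _.
suff -> : s1 = s2 by [].
by apply: eq_in_filter => y hy; rewrite index_cat hy.
Qed.

Lemma size_resolver_seq h : uniq h ->
  size (resolver_seq rfirst h) = if rfirst then uphalf (size h) else (size h)./2.
Proof.
elim/last_ind: h => [|h x IHh]; first by case: rfirst.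
rewrite rcons_uniq => /andP[hx /IHh]; rewrite resolver_seq_rcons // size_rcons.
rewrite /resolver_turn; case: rfirst; rewrite ?addbT ?addbF /= uphalf_half.
  by case: (odd _); rewrite /= ?size_rcons => ->; rewrite ?uphalf_half.
by case: (odd _); rewrite /= ?size_rcons => ->.
Qed.

(** Whose turn it is depends only on the position, so Resolver's moves in an initial part of a play
    begin the list of all his moves. *)
Lemma take_resolver_seq s i : uniq s ->
  resolver_seq rfirst (take i s) =
  take (size (resolver_seq rfirst (take i s))) (resolver_seq rfirst s).
Proof.
elim/last_ind: s => [|s x IHs] //; rewrite rcons_uniq => /andP[sx Us].
case: (leqP i (size s)) => [le_is|lt_si]; last first.
  by rewrite take_oversize ?size_rcons // take_oversize.
rewrite -cats1 takel_cat // cats1 resolver_seq_rcons //; rewrite {1}IHs //.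
case: ifP => // _; rewrite -cats1 takel_cat // IHs // size_take.
by case: ltnP => // /ltnW.
Qed.

(** Ensures that the quantification over plays in a win is not vacuous, as the lower bound
    requires. *)
Lemma exists_play (sigma : strategy X) : legal sigma ->
  exists2 s : #|X|.-tuple X, is_play s & follows rfirst sigma s.
Proof.
move=> /forallP legal_sigma.
pose ok s := uniq s /\ forall j, j < size s -> resolver_turn rfirst j ->
  forall x0, nth x0 s j = sigma (insub_bseq #|X| (take j s)).
have [s [[Us s_ok] sz_s]] : exists s, ok s /\ size s = #|X|.
  suff: forall i, i <= #|X| -> exists s, ok s /\ size s = i by apply.
  elim=> [|i IHi] lt_i; first by exists [::].
  have [s [[Us s_ok] sz_s]] := IHi (ltnW lt_i).
  have [x sx x_ok] : exists2 x, x \notin s &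
      resolver_turn rfirst i -> x = sigma (insub_bseq #|X| s).
    (* On Spoiler's turn any unplayed vertex will do. *)
    case: (resolver_turn rfirst i); last first.
      case: (pickP [predC s]) => [x sx|s_full]; first by exists x.
      suff: #|X| <= i by rewrite leqNgt lt_i.
      rewrite -sz_s -(card_uniqP Us); apply/subset_leq_card/subsetP=> x _.
      by have /negbFE := s_full x.
    exists (sigma (insub_bseq #|X| s)) => //.
    have := legal_sigma (insub_bseq #|X| s); rewrite /=.
    have -> : insub_bseq #|X| s = s :> seq X.
      by rewrite /insub_bseq insubdK // unfold_in sz_s ltnW.
    by rewrite sz_s lt_i.
  exists (rcons s x); split; last by rewrite size_rcons sz_s.
  split=> [|j]; first by rewrite rcons_uniq sx.
  rewrite size_rcons ltnS leq_eqVlt sz_s => /orP[/eqP ->|lt_j] turn_j x0.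
    by rewrite nth_rcons sz_s ltnn eqxx -cats1 -sz_s take_size_cat // x_ok.
  rewrite nth_rcons sz_s lt_j s_ok ?sz_s // -cats1 takel_cat //.
  by rewrite sz_s ltnW.
exists (Tuple (introT eqP sz_s)) => //.
apply/forallP=> i; apply/implyP=> turn_i; apply/eqP.
rewrite (tnth_nth (tnth (Tuple (introT eqP sz_s)) i)) /=.
by apply: s_ok; rewrite ?sz_s.
Qed.

Lemma resolver_wins_within_card k : resolver_wins_within X rfirst k ->
  exists2 W : {set X}, resolving W & #|W| <= k.
Proof.
case/existsP=> sigma /andP[/exists_play[s play_s fol_s] /forallP/(_ s)].
rewrite play_s fol_s => /existsP[W /andP[resW /subset_leq_card sW]].
exists W => //; apply: leq_trans sW (leq_trans (card_size _) _).
by rewrite size_take; case: ltnP.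
Qed.

Lemma resolver_wins_within_wins k :
  resolver_wins_within X rfirst k -> resolver_wins X rfirst.
Proof.
case/existsP=> sigma /andP[legal_sigma /forallP win]; apply/existsP.
exists sigma; rewrite legal_sigma; apply/forallP=> s; apply/implyP.
move/(implyP (win s)) => /existsP[W /andP[resW /subsetP sW]].
apply/existsP; exists W; rewrite resW; apply/subsetP=> x /sW; exact: mem_take.
Qed.

Variable good : {set X} -> {set X} -> bool.

(* [A] is the set of vertices selected by Resolver, [P] that of all selected
   vertices; [good] describes positions in which Spoiler is to move, [ready]
   those in which Resolver is to move. *)
Definition ready A P : bool :=
  (P == setT) || [exists r, (r \notin P) && good (r |: A) (r |: P)].

(** The second [pick] keeps the strategy legal where the invariant fails; [x0] is returned only on a
    full board. *)
Definition invariant_strategy (x0 : X) : strategy X :=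
  [ffun h : {bseq #|X| of X} =>
     let A := [set x in resolver_seq rfirst h] in
     let P := [set x in val h] in
     if [pick r | (r \notin P) && good (r |: A) (r |: P)] is Some r then r
     else odflt x0 [pick r | r \notin P]].

Lemma invariant_strategy_legal x0 : legal (invariant_strategy x0).
Proof.
apply/forallP=> h; apply/implyP=> lt_h; rewrite ffunE /=.
case: pickP => [r /= /andP[]|_] /=; first by rewrite inE.
case: pickP => [r|h_full] /=; first by rewrite inE.
suff: #|X| <= size h by rewrite leqNgt lt_h.
apply: leq_trans (card_size h); apply/subset_leq_card/subsetP=> x _.
by have /negbFE := h_full x; rewrite inE.
Qed.

Lemma invariant_strategy_wins (x0 : X) k :
    (if rfirst then ready set0 set0 else good set0 set0) ->
    (forall A P v, good A P -> v \notin P -> ready A (v |: P)) ->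
    (forall A P, good A P -> #|A| = k -> resolving A) ->
    0 < k -> k.*2 <= #|X| ->
  resolver_wins_within X rfirst k.
Proof.
move=> start spoiler_step finish k_gt0 le_k; apply/existsP.
exists (invariant_strategy x0); rewrite invariant_strategy_legal /=.
apply/forallP=> s; apply/implyP=> /andP[Us /forallP fol_s].
have sz_s := size_tuple s.
pose Aof h := [set x in resolver_seq rfirst h]; pose Pof h := [set x : X in h].
have inv i : i <= #|X| ->
    (if resolver_turn rfirst i then ready else good)
      (Aof (take i s)) (Pof (take i s)).
  elim: i => [_|i IHi lt_i].
    have -> : Aof (take 0 s) = set0 by apply/setP=> x; rewrite take0 !inE.
    have -> : Pof (take 0 s) = set0 by apply/setP=> x; rewrite take0 !inE.
    by rewrite /resolver_turn; case: (rfirst) start.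
  have := IHi (ltnW lt_i); set x := tnth s (Ordinal lt_i).
  have take_i : take i.+1 s = rcons (take i s) x.
    by rewrite (take_nth x0) ?sz_s // /x (tnth_nth x0).
  have sx : x \notin take i s.
    by have := take_uniq i.+1 Us; rewrite take_i rcons_uniq => /andP[].
  have sz_i : size (take i s) = i by rewrite size_takel // sz_s ltnW.
  have -> : Pof (take i.+1 s) = x |: Pof (take i s).
    by apply/setP=> y; rewrite take_i !inE mem_rcons inE.
  rewrite /Aof take_i resolver_seq_rcons // sz_i.
  have -> : resolver_turn rfirst i.+1 = ~~ resolver_turn rfirst i.
    by rewrite /resolver_turn /= addNb.
  have [turn_i|_] := boolP (resolver_turn rfirst i); last first.
    by move=> /spoiler_step; apply; rewrite inE.
  case/orP=> [/eqP/setP/(_ x)|]; first by rewrite !inE (negPf sx).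
  case/existsP=> r r_ok; have /eqP := implyP (fol_s (Ordinal lt_i)) turn_i.
  rewrite -/x ffunE /=.
  have -> : insub_bseq #|X| (take i s) = take i s :> seq X.
    by rewrite /insub_bseq insubdK // unfold_in sz_i ltnW.
  case: pickP => [r1 /andP[_ good_r1] /= ->|/(_ r)]; last by rewrite r_ok.
  suff <- : r1 |: Aof (take i s) =
      [set y in rcons (resolver_seq rfirst (take i s)) r1] by [].
  by apply/setP=> y; rewrite !inE mem_rcons inE.
(* The time just after Resolver's [k]-th move: 2k - 1 moves in the R-game, 2k in the S-game. At [T]
   the turn is Spoiler's, so the invariant yields [good], not just [ready]. *)
pose T := k.*2 - rfirst.
have le_T : T <= #|X| by apply: leq_trans (leq_subr _ _) le_k.
have szT : size (resolver_seq rfirst (take T s)) = k.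
  rewrite size_resolver_seq ?take_uniq // size_takel ?sz_s // /T.
  case: (rfirst); rewrite ?subn0 ?doubleK //.
  by case: (k) k_gt0 => // j _; rewrite doubleS subn1 /= doubleK.
have turnT : resolver_turn rfirst T = false.
  rewrite /resolver_turn /T oddB ?odd_double ?addFb.
    by case: (rfirst).
  by case: (k) k_gt0 => // j _; case: (rfirst).
have := inv T le_T; rewrite turnT => /finish fin.
apply/existsP; exists (Aof (take T s)); apply/andP; split.
  by apply: fin; rewrite cardsE (card_uniqP _) // filter_uniq // take_uniq.
by apply/subsetP=> x; rewrite inE take_resolver_seq // szT.
Qed.

End InvariantStrategy.

Lemma min_moves_eq (X : sgraph) rfirst k : k <= #|X| ->
  resolver_wins_within X rfirst k ->
  (forall j, j < k -> ~~ resolver_wins_within X rfirst j) ->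
  min_moves X rfirst = Some k.
Proof.
move=> le_k win_k lt_k; rewrite /min_moves -addn1 -(subnKC le_k) -addnA addn1.
rewrite iotaD filter_cat /= win_k (eq_in_filter (a2 := pred0)) ?filter_pred0 //.
by move=> j; rewrite mem_iota => /lt_k/negPf.
Qed.

(** * Lexicographic products *)

Section LexGame.
Variables G H : sgraph.
Implicit Types (g : G) (a b c h v w : H) (A P : {set lexprod G H}).

Definition fiber A g : {set H} := [set h | (g, h) \in A].

Lemma fiberU1 A (x : lexprod G H) g :
  fiber (x |: A) g = if g == x.1 then x.2 |: fiber A g else fiber A g.
Proof.
by apply/setP=> h; case: x => u k; case: eqP => [->|gu] /=;
  rewrite !inE xpair_eqE ?eqxx //; case: eqP.
Qed.

Lemma card_fibers A : #|A| = \sum_g #|fiber A g|.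
Proof.
rewrite -sum1_card big_mkcond /=.
rewrite (eq_bigr (fun x => if (x.1, x.2) \in A then 1 else 0)).
  rewrite -(pair_bigA _ (fun g h => if (g, h) \in A then 1 else 0)) /=.
  apply: eq_bigr => g _; rewrite -sum1_card [RHS]big_mkcond /=.
  by apply: eq_bigr => h _; rewrite inE.
by case.
Qed.

(** Leaving out [g] and [g'] themselves covers both kinds: true twins if adjacent, false twins if
    not. *)
Definition twins g g' :=
  [forall u, (u != g) && (u != g') ==> (edge g u == edge g' u)].

Definition false_twin g := [exists u, [&& u != g, ~~ edge g u & twins g u]].

(** A false twin [u] of [g] would be adjacent to [g'], as [g] is; then [g], a true twin of [g'],
    would be adjacent to [u]. *)
Lemma twins_no_false_twin g g' : twins g g' -> edge g g' -> ~~ false_twin g.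
Proof.
move=> /forallP tw gg'; apply/existsP=> -[u /and3P[ug ngu /forallP tw']].
have ug' : u != g' by apply: contraNneq ngu => ->.
have g'g : g' != g by apply: contraTneq gg' => ->; rewrite edge_irr.
have := tw u; rewrite ug ug' (negPf ngu) /= => /eqP e1.
by have := tw' g'; rewrite g'g eq_sym ug' gg' /= edge_sym -e1.
Qed.

(* [t g] is the set of pairs with which Resolver wants to finish in the layer
   of [g]. *)
Variable t : G -> rel H.

Definition settled g (B : {set H}) :=
  [exists a, exists b, [&& t g a b, a \in B & b \in B]].

Definition won A := [forall g, settled g (fiber A g)].

Hypothesis t_irr : forall g, irreflexive (t g).
(** Once Spoiler has opened a layer with [v], the answer [r] leaves two completions, and she cannot
    block both in one move. *)
Hypothesis t_reply : forall g v, exists r b c,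
  [&& r != v, b != v, c != v, b != c, t g r b & t g r c].
Hypothesis t_resolves : forall g a b h h', t g a b -> h != h' ->
  exists2 w, w \in [set a; b] & [|| w == h, w == h' | edge h w != edge h' w].
Hypothesis t_true_twin : forall g g' a b h, t g a b -> twins g g' ->
  edge g g' -> exists2 w, w \in [set a; b] & ~~ edge h w.
Hypothesis t_false_twin : forall g a b h, t g a b -> false_twin g ->
  exists2 w, w \in [set a; b] & (w == h) || edge h w.

(** Within a layer the wanted pair resolves. If [g] and [g'] are not twins, some [u] is adjacent to
    exactly one of them, and so is any selected vertex of its layer. For twins, a vertex of the pair
    in layer [g] relates to [(g, h)] differently than to the whole layer of [g']. *)
Lemma won_resolving A : won A -> resolving A.
Proof.
move=> /forallP wonA; apply/forallP=> -[g h]; apply/forallP=> -[g' h'].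
apply/implyP=> xy.
suff [z Az z_ok] : exists2 z : lexprod G H, z \in A &
    [|| z == (g, h), z == (g', h') |
      @edge (lexprod G H) (g, h) z != @edge (lexprod G H) (g', h') z].
  by apply/existsP; exists z; rewrite Az; exact: dist_neq.
have /existsP[a /existsP[b /and3P[tab Aa Ab]]] := wonA g.
have in_A w : w \in [set a; b] -> (g, w) \in A.
  by case/set2P=> ->; [move: Aa | move: Ab]; rewrite inE.
case: (eqVneq g g') xy => [<-|gg'] xy.
  have hh' : h != h' by apply: contraNneq xy => ->.
  have [w /in_A Aw w_ok] := t_resolves tab hh'; exists (g, w) => //.
  by rewrite !xpair_eqE eqxx /= /lex_edge /= edge_irr eqxx.
have [tw|] := boolP (twins g g'); last first.
  case/forallPn=> u; rewrite negb_imply => /andP[/andP[ug ug'] eu].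
  have /existsP[c /existsP[_ /and3P[_ Ac _]]] := wonA u.
  exists (u, c); first by move: Ac; rewrite inE.
  rewrite /= /lex_edge /= ![_ == u]eq_sym (negPf ug) (negPf ug') /= !orbF.
  by rewrite eu !orbT.
have [e|ne] := boolP (edge g g').
  have [w /in_A Aw w_ok] := t_true_twin h tab tw e; exists (g, w) => //.
  rewrite /= /lex_edge /= edge_irr eqxx (negPf w_ok) /=.
  by rewrite [edge g' g]edge_sym e !orbT.
have ft : false_twin g by apply/existsP; exists g'; rewrite eq_sym gg' ne.
have [w /in_A Aw w_ok] := t_false_twin h tab ft; exists (g, w) => //.
rewrite !xpair_eqE eqxx /= /lex_edge /= edge_irr eqxx [g' == g]eq_sym.
rewrite (negPf gg') [edge g' g]edge_sym (negPf ne) /=.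
by case/orP: w_ok => ->; rewrite ?orbT.
Qed.

(** * Resolver's play inside the layers *)

Definition threat g (B Q : {set H}) :=
  [exists a, exists b, exists c,
    [&& B == [set a], t g a b, t g a c, b != c, b \notin Q & c \notin Q]].

(** Equality rather than inclusion: no third vertex is spent in a layer before the win, so counting
    moves detects completion. *)
Definition done g (B : {set H}) :=
  [exists a, exists b, t g a b && (B == [set a; b])].

Definition layer_ok g (B Q : {set H}) :=
  [|| (B == set0) && (Q == set0), threat g B Q | done g B].

(** Play goes on until the board is full, so after the win extra vertices may spoil [layer_ok]; the
    disjunct [won A] absorbs them. *)
Definition good A P :=
  won A || [forall g, layer_ok g (fiber A g) (fiber P g)].

Lemma done_settled g B : done g B -> settled g B.
Proof.
case/existsP=> a /existsP[b /andP[tab /eqP ->]].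
by apply/existsP; exists a; apply/existsP; exists b; rewrite tab !inE !eqxx orbT.
Qed.

(** The set [Q'] allows for two uses: Spoiler has really played [v], or [v] is only imagined and
    [Q'] is [Q]. *)
Lemma layer_reply g B Q v : layer_ok g B Q -> ~~ done g B ->
  exists2 r, r \notin v |: Q &
    forall Q' : {set H}, Q' \subset v |: Q -> layer_ok g (r |: B) (r |: Q').
Proof.
rewrite /layer_ok => /or3P[/andP[/eqP -> /eqP ->]|th|->] // _.
  have [r [b [c /and5P[rv bv cv bc /andP[trb trc]]]]] := t_reply g v.
  exists r => [|Q' /subsetP sQ']; first by rewrite !inE orbF.
  apply/orP; right; apply/orP; left.
  apply/existsP; exists r; apply/existsP; exists b; apply/existsP; exists c.
  rewrite setU0 eqxx trb trc bc !inE !negb_or /=.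
  have br : b != r by apply: contraTneq trb => ->; rewrite t_irr.
  have cr : c != r by apply: contraTneq trc => ->; rewrite t_irr.
  rewrite br cr /=; apply/andP; split.
    by apply: (contra (sQ' b)); rewrite !inE orbF.
  by apply: (contra (sQ' c)); rewrite !inE orbF.
have [a [r [tar rQ rv /eqP ->]]] :
    exists a r, [/\ t g a r, r \notin Q, r != v & B == [set a]].
  case/existsP: th => a /existsP[b /existsP[c]].
  case/and5P=> Ba tab tac bc /andP[bQ cQ].
  case: (eqVneq b v) bc => [->|bv] bc; last by exists a, b.
  by exists a, c; rewrite eq_sym.
exists r => [|Q' _]; first by rewrite !inE negb_or rv.
apply/orP; right; apply/orP; right; apply/existsP; exists a; apply/existsP.
by exists r; rewrite tar setUC eqxx.
Qed.

(** A free move for Resolver does no harm: in an unfinished layer he answers an imaginary move of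
    Spoiler. *)
Lemma good_ready A P : good A P -> ready good A P.
Proof.
rewrite /ready; case: (eqVneq P setT) => //= nP.
have [wonA _|nwon] := boolP (won A).
  have [r Pr] : exists r, r \notin P.
    apply/existsP; rewrite -negb_forall; apply: contra nP => /forallP fP.
    by apply/eqP/setP=> x; rewrite inE fP.
  apply/existsP; exists r; rewrite Pr; apply/orP; left; apply/forallP=> g.
  have /existsP[a /existsP[b /and3P[tab]]] := forallP wonA g.
  rewrite !inE => Aa Ab.
  apply/existsP; exists a; apply/existsP; exists b.
  by rewrite tab !inE Aa Ab !orbT.
rewrite /good (negPf nwon) => /forallP okA.
have /forallPn[g ng] := nwon.
have nd : ~~ done g (fiber A g) by apply: contra ng; apply: done_settled.
have [r] : exists2 r, r \notin fiber P g &
    layer_ok g (r |: fiber A g) (r |: fiber P g).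
  case: (pickP (fun v => v \in fiber P g)) => [v vP|P0].
    have [r rP r_ok] := layer_reply v (okA g) nd.
    exists r; last by apply: r_ok; apply: subsetUr.
    by apply: contra rP => rP; rewrite inE rP orbT.
  (* Any vertex of [H] serves as the imaginary move; one comes from the state of the layer or from
     an unplayed vertex of the board. *)
  have [v _] : exists v : H, true.
    case/or3P: (okA g) => [_|/existsP[a _]|/existsP[a _]]; last 2 first.
    - by exists a.
    - by exists a.
    have [[u v] _|X0] := pickP [pred x : lexprod G H | x \notin P].
      by exists v.
    case/eqP: nP; apply/setP=> x; rewrite inE.
    by have /negbFE := X0 x.
  have [r rP r_ok] := layer_reply v (okA g) nd.
  exists r; last by apply: r_ok; apply: subsetUr.
  by rewrite P0.
rewrite inE => rP r_ok; apply/existsP; exists (g, r); rewrite rP.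
apply/orP; right; apply/forallP=> u; rewrite !fiberU1 /=.
by case: eqP => [->|].
Qed.

Lemma good_spoiler_step A P x : good A P -> x \notin P -> ready good A (x |: P).
Proof.
move=> goodAP xP; case/orP: (goodAP) => [wonA|/forallP okA].
  by apply: good_ready; apply/orP; left.
case: x xP => g v xP.
have [d|nd] := boolP (done g (fiber A g)).
  apply: good_ready; apply/orP; right; apply/forallP=> u; rewrite fiberU1 /=.
  by case: eqP => [->|_ //]; rewrite /layer_ok d !orbT.
have [r rP r_ok] := layer_reply v (okA g) nd.
apply/orP; right; apply/existsP; exists (g, r); apply/andP; split.
  by move: rP; rewrite !inE xpair_eqE eqxx.
apply/orP; right; apply/forallP=> u; rewrite !fiberU1 /=.
by case: eqP => [->|]; first exact: r_ok.
Qed.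

Lemma good_start : good set0 set0.
Proof.
apply/orP; right; apply/forallP=> g; apply/orP; left.
have -> : fiber set0 g = set0 by apply/setP=> h; rewrite !inE.
by rewrite eqxx.
Qed.

(** The equality case, summed over all layers, shows that 2 * [#|G|] selected vertices complete
    every layer. *)
Lemma card_layer_ok g B Q : layer_ok g B Q -> #|B| <= 2 ?= iff done g B.
Proof.
case/or3P=> [/andP[/eqP -> _]|/existsP[a /existsP[b /existsP[c]]]|d].
- rewrite cards0; split=> //; apply/esym/existsP=> -[a /existsP[b]].
  by case/andP=> _ /eqP/setP/(_ a); rewrite !inE eqxx.
- case/andP=> /eqP -> _; rewrite cards1; split=> //; apply/esym/existsP.
  case=> u /existsP[v /andP[tuv /eqP e]].
  have := cards2 u v; rewrite -e cards1; case: eqP => // uv.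
  by rewrite uv t_irr in tuv.
have /existsP[a /existsP[b /andP[tab /eqP ->]]] := d.
rewrite cards2; case: eqP tab => [->|_ tab]; first by rewrite t_irr.
split=> //; rewrite eqxx; apply/esym/existsP; exists a; apply/existsP.
by exists b; rewrite tab eqxx.
Qed.

Lemma good_finish A P : good A P -> #|A| = 2 * #|G| -> resolving A.
Proof.
move=> goodAP cA; apply: won_resolving; case/orP: goodAP => // /forallP okA.
have [_] := leqif_sum (fun g (_ : true) => card_layer_ok (okA g)).
rewrite -card_fibers cA sum_nat_const mulnC eqxx => /esym/forallP dA.
by apply/forallP=> g; apply: done_settled; apply: dA.
Qed.

Lemma lex_resolver_wins rfirst : 0 < #|G| -> 4 <= #|H| ->
  resolver_wins_within (lexprod G H) rfirst (2 * #|G|).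
Proof.
move=> G_gt0 H_ge4.
have /card_gt0P[g _] := G_gt0.
have /card_gt0P[h _] : 0 < #|H| by apply: leq_trans H_ge4.
apply: (@invariant_strategy_wins _ _ good (g, h)).
- by case: rfirst; [apply: good_ready|]; apply: good_start.
- exact: good_spoiler_step.
- exact: good_finish.
- by rewrite muln_gt0.
by rewrite card_prod -mul2n mulnA mulnC leq_mul2l H_ge4 orbT.
Qed.

End LexGame.

(** * Two vertices per layer are necessary *)

Lemma card_fiber_resolving (G H : sgraph) (W : {set lexprod G H}) (g : G)
    (w0 : H) :
    (forall w : H, exists f : H -> H,
      [/\ involutive f, {homo f : x y / edge x y}, f w = w
        & exists h, f h != h]) ->
  resolving W -> 2 <= #|fiber W g|.
Proof.
move=> reflection resW; rewrite ltnNge; apply/negP=> le1.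
have [w Ww] : exists w, forall h, h \in fiber W g -> h = w.
  case: (set_0Vmem (fiber W g)) => [->|[w Ww]].
    by exists w0 => h; rewrite inE.
  exists w => h Wh; have /card_le1_eqP := le1; exact.
have [rho [rhoK rho_edge rho_fix [h rh]]] := reflection w.
(* This automorphism fixes [W] pointwise but moves [(g, h)], so [W] cannot separate that vertex from
   its image. *)
pose f (x : lexprod G H) : lexprod G H :=
  if x.1 == g then (g, rho x.2) else x.
have fK : involutive f.
  case=> u k; rewrite /f /=; case: (eqVneq u g) => [->|nu] /=.
    by rewrite eqxx rhoK.
  by rewrite (negPf nu).
have f1 x : (f x).1 = x.1 by rewrite /f; case: eqP => [->|].
have f_edge : {homo f : x y / edge x y}.
  move=> x y /orP[e|/andP[/eqP e1 e2]]; apply/orP; first by left; rewrite !f1.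
  right; rewrite !f1 e1 eqxx /f e1; case: eqP => //= _; exact: rho_edge.
have fW z : z \in W -> f z = z.
  case: z => u k; rewrite /f /=; case: eqP => [-> Wk|//].
  by rewrite (Ww k) ?rho_fix // inE.
have := forallP (forallP resW (f (g, h))) (g, h).
rewrite {1}/f eqxx xpair_eqE eqxx rh /= => /existsP[z /andP[Wz]].
by rewrite -{1}(fW z Wz) dist_involution // eqxx.
Qed.

Lemma lex_resolving_card (G H : sgraph) (W : {set lexprod G H}) (w0 : H) :
    (forall w : H, exists f : H -> H,
      [/\ involutive f, {homo f : x y / edge x y}, f w = w
        & exists h, f h != h]) ->
  resolving W -> 2 * #|G| <= #|W|.
Proof.
move=> reflection resW; rewrite card_fibers mulnC -sum_nat_const.
by apply: leq_sum => g _; apply: card_fiber_resolving resW.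
Qed.

(** * Cycles of length four and five *)

Lemma pair_witness (T : finType) (Q : pred T) (a b : T) :
  Q a || Q b -> exists2 w, w \in [set a; b] & Q w.
Proof. by case/orP=> ?; [exists a | exists b]; rewrite // !inE eqxx ?orbT. Qed.

Definition mod_ord (n k : nat) : 'I_n.+1 := Ordinal (ltn_pmod k (ltn0Sn n)).

(** The map sending h to 2w - h modulo n + 1; the summand [n.+1] prevents truncation of the
    subtraction. *)
Definition reflect_ord (n : nat) (w h : 'I_n.+1) : 'I_n.+1 :=
  mod_ord n (w + w + n.+1 - h).

Ltac case_ord4 := case=> -[|[|[|[|?]]]] //= ?.
Ltac case_ord5 := case=> -[|[|[|[|[|?]]]]] //= ?.

Lemma cycle_reflection (n : nat) : n = 4 \/ n = 5 -> forall w : cycle_graph n,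
  exists f : cycle_graph n -> cycle_graph n,
  [/\ involutive f, {homo f : x y / edge x y}, f w = w & exists h, f h != h].
Proof.
case=> -> w.
  exists (@reflect_ord 3 w); split; last exists (mod_ord 3 w.+1); move: w.
  - by case_ord4; case_ord4; apply: val_inj.
  - by case_ord4; case_ord4; case_ord4.
  - by case_ord4; apply: val_inj.
  - by case_ord4.
exists (@reflect_ord 4 w); split; last exists (mod_ord 4 w.+1); move: w.
- by case_ord5; case_ord5; apply: val_inj.
- by case_ord5; case_ord5; case_ord5.
- by case_ord5; apply: val_inj.
- by case_ord5.
Qed.

Section WantedPairs.
Variables (G : sgraph) (n : nat).
Hypothesis n45 : n = 4 \/ n = 5.

(* In the 5-cycle an edge is not dominating, which matters for false twins,
   and a non-edge has a common neighbour, which matters for true twins. *)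
Definition wanted (g : G) : rel (cycle_graph n) := fun a b =>
  if (n == 5) && false_twin g then (a != b) && ~~ edge a b else edge a b.

Lemma wanted_irr g : irreflexive (wanted g).
Proof. by move=> a; rewrite /wanted edge_irr eqxx if_same. Qed.

Lemma wanted_reply g v : exists r b c,
  [&& r != v, b != v, c != v, b != c, wanted g r b & wanted g r c].
Proof.
rewrite /wanted; case: n45 v => -> /= v.
  (* The vertex at distance 2 from [v] has both its neighbours different from [v]. *)
  by exists (mod_ord 3 (v + 2)), (mod_ord 3 (v + 1)), (mod_ord 3 (v + 3));
    move: v; case_ord4.
case: false_twin.
  (* For non-edges a neighbour of [v] is taken, since [v] is then not among its two
     non-neighbours. *)
  by exists (mod_ord 4 (v + 1)), (mod_ord 4 (v + 3)), (mod_ord 4 (v + 4));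
    move: v; case_ord5.
by exists (mod_ord 4 (v + 2)), (mod_ord 4 (v + 1)), (mod_ord 4 (v + 3));
  move: v; case_ord5.
Qed.

Lemma wanted_resolves g a b h h' : wanted g a b -> h != h' ->
  exists2 w, w \in [set a; b] & [|| w == h, w == h' | edge h w != edge h' w].
Proof.
rewrite /wanted => wab hh'; apply: pair_witness; move: a b h h' wab hh'.
case: n45 => -> /=; first by do 4!case_ord4.
by case: false_twin; do 4!case_ord5.
Qed.

Lemma wanted_true_twin g g' a b h : wanted g a b -> twins g g' ->
  edge g g' -> exists2 w, w \in [set a; b] & ~~ edge h w.
Proof.
move=> wab tw e; apply: pair_witness; move: wab.
(* With a true twin the wanted pairs are edges, and neither cycle has triangles. *)
rewrite /wanted (negPf (twins_no_false_twin tw e)) andbF.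
by move: a b h; case: n45 => -> /=; [do 3!case_ord4 | do 3!case_ord5].
Qed.

Lemma wanted_false_twin g a b h : wanted g a b -> false_twin g ->
  exists2 w, w \in [set a; b] & (w == h) || edge h w.
Proof.
move=> wab ft; apply: (@pair_witness _ (fun w => (w == h) || edge h w)).
move: wab; rewrite /wanted ft andbT.
by move: a b h; case: n45 => -> /=; [do 3!case_ord4 | do 3!case_ord5].
Qed.

End WantedPairs.

Theorem theorem5p4 (G : sgraph) (n : nat)
    (G_connected : connected_graph G) (G_card : 2 <= #|G|)
    (n45 : n = 4 \/ n = 5) :
  [/\ outcome_R (lexprod G (cycle_graph n)),
      R_MB (lexprod G (cycle_graph n)) = Some (2 * #|G|)
    & R_MB' (lexprod G (cycle_graph n)) = Some (2 * #|G|)].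
Proof.
have n_ge4 : 4 <= #|cycle_graph n| by rewrite card_ord; case: n45 => ->.
have win rfirst :
    resolver_wins_within (lexprod G (cycle_graph n)) rfirst (2 * #|G|).
  apply: (@lex_resolver_wins _ _ (@wanted G n)) => //.
  - exact: wanted_irr.
  - exact: wanted_reply.
  - exact: wanted_resolves.
  - exact: wanted_true_twin.
  - exact: wanted_false_twin.
  - exact: ltnW.
have minimal rfirst j : j < 2 * #|G| ->
    ~~ resolver_wins_within (lexprod G (cycle_graph n)) rfirst j.
  move=> lt_j; apply/negP=> /resolver_wins_within_card[W resW le_j].
  have /card_gt0P[h _] : 0 < #|cycle_graph n| by apply: leq_trans n_ge4.
  have := lex_resolving_card h (cycle_reflection n45) resW.
  by rewrite leqNgt (leq_ltn_trans le_j lt_j).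
have le_card : 2 * #|G| <= #|lexprod G (cycle_graph n)|.
  by rewrite card_prod mulnC leq_mul2l (leq_trans _ n_ge4) ?orbT.
split; first by move=> rfirst; apply: resolver_wins_within_wins (win rfirst).
- by apply: min_moves_eq => // j; apply: minimal.
- by apply: min_moves_eq => // j; apply: minimal.
Qed.
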